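(* There exist injective polynomial maps $f \colon \mathbb{Z} \to \mathbb{Z}$ (with $f \in \mathbb{Z}[x]$ a univariate polynomial) such that, for every prime number $p$, the induced polynomial map $f \colon \mathbb{Z}_{(p)} \to \mathbb{Z}_{(p)}$ is not injective.
   Context: $\mathbb{Z}_{(p)}$ denotes the localization of $\mathbb{Z}$ at the prime ideal $(p)$, i.e. the ring of rational numbers with denominator prime to $p$. The polynomial map induced by $f\in\mathbb{Z}[x]$ on a ring $S$ is $a \mapsto f(a)$. *)

(* Defs.v *)
From HB Require Import structures.
From mathcomp Require Import all_boot all_order all_algebra.

Set Implicit Arguments.
Unset Strict Implicit.
Unset Printing Implicit Defensive.

Import GRing.Theory Num.Theory.
Local Open Scope ring_scope.

(* [denq x] is the positive denominator of [x] in lowest terms. The predicate  *)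
(* defines a subring of [rat] for every [p : nat]; for [p] prime this subring  *)
(* is the localization of the integers at the prime ideal (p).                 *)
Definition loc_int (p : nat) : {pred rat} :=
  fun x => coprime p `|denq x|%N.

Lemma loc_intP (p : nat) (x : rat) (d : int) :
  coprime p `|d|%N -> x * d%:~R \is a Num.int -> x \in loc_int p.
Proof.
move=> cpd /intrP[a xd]; apply: coprime_dvdr cpd.
suff: (`|denq x| %| `|numq x| * `|d|)%N.
  by rewrite Gauss_dvdr // coprime_sym coprime_num_den.
suff ->: (`|numq x| * `|d| = `|a| * `|denq x|)%N by apply: dvdn_mull.
rewrite -!abszM; congr absz; apply: (intr_inj (R := rat)).
by rewrite !intrM -xd numqE mulrAC.
Qed.

Lemma loc_int_subring (p : nat) : subring_closed (loc_int p).
Proof.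
have denI (x : rat) : x * (denq x)%:~R \is a Num.int.
  by rewrite -numqE intr_int.
split=> [|x y px py|x y px py].
- by rewrite unfold_in /loc_int (denq_int 1) coprimen1.
- apply: (@loc_intP _ _ (denq x * denq y)); first by rewrite abszM coprimeMr; apply/andP.
  rewrite intrM mulrBl mulrA [y * _]mulrCA.
  by apply: rpredB; apply: rpredM; rewrite ?intr_int.
- apply: (@loc_intP _ _ (denq x * denq y)); first by rewrite abszM coprimeMr; apply/andP.
  by rewrite intrM mulrACA rpredM.
Qed.

HB.instance Definition _ (p : nat) :=
  GRing.isSubringClosed.Build rat (loc_int p) (@loc_int_subring p).

Record Zloc (p : nat) := ZLoc { Zloc_val : rat; Zloc_valP : Zloc_val \in loc_int p }.

HB.instance Definition _ (p : nat) := [isSub for @Zloc_val p].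
HB.instance Definition _ (p : nat) := [Choice of Zloc p by <:].
HB.instance Definition _ (p : nat) :=
  [SubChoice_isSubComNzRing of Zloc p by <:].

Definition poly_fun (S : nzRingType) (f : {poly int}) : S -> S :=
  fun a => (map_poly intr f).[a].

Arguments poly_fun S f a : clear implicits.

(* Main.v *)
Require Import Defs.
From mathcomp Require Import all_boot all_order all_algebra.
From mathcomp Require Import ring zify.

(** The polynomial f = X (2 X - 1) (3 X - 1) works. Its three rational roots
    0, 1/2 and 1/3 are distinct, and the denominators 2 and 3 are coprime:
    every localization of the integers at a prime contains 1/3 or 1/2, so f
    takes the value 0 there at least twice.
    Over the integers, with t = x + y and d = x - y,
      2 (f(x) - f(y)) = d (9 t^2 - 10 t + 2 + 3 d^2),
    where the quadratic factor is the one whose zero set is an ellipse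
    through the points (0, 1/2) and (0, 1/3). If d <> 0 then d^2 >= 1, so this
    factor is at least 9 t^2 - 10 t + 5, which has negative discriminant;
    hence f is injective on the integers. *)

Set Implicit Arguments.
Unset Strict Implicit.
Unset Printing Implicit Defensive.

Import Order.TTheory GRing.Theory Num.Theory.
Local Open Scope ring_scope.

Definition root_half_third : {poly int} :=
  'X * (2%:R * 'X - 1) * (3%:R * 'X - 1).

Lemma poly_fun_root_half_third (S : comNzRingType) (a : S) :
  poly_fun S root_half_third a = a * (2%:R * a - 1) * (3%:R * a - 1).
Proof.
rewrite /poly_fun /root_half_third !(rmorphM, rmorphB, rmorph1, rmorph_nat) /=.
by rewrite map_polyX -!polyC_natr !(hornerM, hornerD, hornerN, hornerX, hornerC).
Qed.

(** The ellipse of the off-diagonal coincidences is so small that it meets the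
    integer lattice in no point off the diagonal. *)
Lemma root_half_third_inj : injective (poly_fun int root_half_third).
Proof.
move=> x y; rewrite !poly_fun_root_half_third => fxy.
apply/eqP; rewrite -subr_eq0; apply/negP => /negP d_neq0.
have d2_ge1 : 1 <= (x - y) ^+ 2 by rewrite -gtz0_ge1 exprn_even_gt0.
have /eqP : (x - y) *
  (9 * (x + y) ^+ 2 - 10 * (x + y) + 2 + 3 * (x - y) ^+ 2) = 0.
  transitivity (2 * (x * (2 * x - 1) * (3 * x - 1)
                     - y * (2 * y - 1) * (3 * y - 1))); first by ring.
  by rewrite fxy subrr mulr0.
rewrite mulf_eq0 (negPf d_neq0) /= => /eqP.
(* Completing the square: 9 (9 t^2 - 10 t + 5) = (9 t - 5)^2 + 20 > 0. *)
by have := sqr_ge0 (9 * (x + y) - 5); lia.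
Qed.

Lemma invn_loc_int (p n : nat) :
  coprime p n -> (0 < n)%N -> (n%:R^-1 : rat) \in loc_int p.
Proof.
move=> cpn n_gt0; apply: (@loc_intP _ _ n) => //.
by rewrite mulVf ?rpred1 // pnatr_eq0 -lt0n.
Qed.

(** The roots 0 and 1/n collide under f. The hypothesis is stated in [rat]
    because its instances [n = 2] and [n = 3] are plain computations there. *)
Lemma root_half_third_not_inj (p n : nat) :
  coprime p n -> (0 < n)%N ->
  poly_fun rat root_half_third n%:R^-1 = 0 ->
  ~ injective (poly_fun (Zloc p) root_half_third).
Proof.
move=> cpn n_gt0; rewrite poly_fun_root_half_third => fn0 inj.
pose a : Zloc p := ZLoc (invn_loc_int cpn n_gt0).
suff /inj/(congr1 val) : poly_fun _ root_half_third a
                       = poly_fun _ root_half_third 0.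
  by rewrite rmorph0 => /eqP; rewrite invr_eq0 pnatr_eq0 -leqn0 leqNgt n_gt0.
rewrite !poly_fun_root_half_third !mul0r; apply: val_inj.
by rewrite !(rmorphM, rmorphB, rmorph1, rmorph_nat, rmorph0).
Qed.

Theorem proposition5p1 :
  exists f : {poly int},
    injective (poly_fun int f) /\
    forall p : nat, prime p -> ~ injective (poly_fun (Zloc p) f).
Proof.
exists root_half_third; split=> [|p p_prime]; first exact: root_half_third_inj.
have [->|p_neq2] := eqVneq p 2%N.
  by apply: (@root_half_third_not_inj _ 3); rewrite ?poly_fun_root_half_third.
apply: (@root_half_third_not_inj _ 2); rewrite ?poly_fun_root_half_third //.
by rewrite prime_coprime // dvdn_prime2.
Qed.
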